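(* Let $\mathcal{T}=(V,A,E,f,q,v_0)$ be a decorated pseudo-rooted tree and let $\mathscr{P}$ be a partition of $A\setminus A_0$. Then (a) $M(\mathcal{T})=\sum_{\alpha\in A\setminus A_0}M(\mathcal{T}_\alpha)+\sum_{\alpha\in A\setminus A_0}\mathfrak{M}(\mathcal{T},\{\alpha\})-I(A\setminus A_0,A\setminus A_0)$; (b) $M(\mathcal{T})=\sum_{X\in\mathscr{P}}M(\mathcal{T}_X)+\sum_{X\in\mathscr{P}}\mathfrak{M}(\mathcal{T},X)-\sum_{(X,Y)\in\mathscr{P}^2,\,X\neq Y}I(X,Y)$.
   Context: A graph is a pair $(X_0,X_1)$ of finite sets such that each element of $X_1$ (an edge) is a $2$-element subset of $X_0$; elements of $X_0$ are called cells. The valency $\delta_x$ of a cell $x$ is the number of edges containing $x$. A path is a tuple $(x_0,\dots,x_n)$ ($n\ge 0$) of cells such that $\{x_i,x_{i+1}\}$ is an edge for each $i<n$ and these edges are pairwise distinct; a cell (resp. edge) is in the path if it is one of the $x_i$ (resp. one of the $\{x_i,x_{i+1}\}$). The graph is a tree if for any cells $x,y$ there is a unique path from $x$ to $y$, denoted $\gamma_{x,y}$. A decorated tree is a $5$-tuple $(V,A,E,f,q)$ where $V$ (vertices) and $A$ (arrows) are finite disjoint sets, $(V\cup A,E)$ is a tree, every arrow has valency $1$, $f:A\to\mathbb{Z}$, $q$ assigns an integer $q(e,x)$ to each pair $(e,x)$ with $e\in E$, $x\in e$, such that $q(e,\alpha)=1$ whenever $\alpha\in A$, and for every $v\in V$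 and distinct edges $e,e'$ containing $v$, $\gcd(q(e,v),q(e',v))=1$. Let $A_0=\{\alpha\in A: f(\alpha)=0\}$. For $x\in V\cup A$ and an edge $e\ni x$, $Q(e,x)=\prod q(e',x)$ over edges $e'\neq e$ containing $x$ (empty products equal $1$). An edge $\varepsilon$ is incident to a path $\gamma$ if $\varepsilon$ is not in $\gamma$ but contains some cell $u$ of $\gamma$; then $q(\varepsilon,\gamma):=q(\varepsilon,u)$. For $v\in V\cup A$, $\alpha\in A$, $v\ne\alpha$: $x_{v,\alpha}=f(\alpha)\prod_\varepsilon q(\varepsilon,\gamma_{v,\alpha})$ over all edges $\varepsilon$ incident to $\gamma_{v,\alpha}$. For $v\in V\cup A_0$, $N_v=\sum_{\alpha\in A\setminus A_0}x_{v,\alpha}$, and $M(\mathcal{T})=-\sum_{v\in V\cup A_0}N_v(\delta_v-2)$. For a path $\gamma=(x_0,\dots,x_n)$ with $n>0$ and a cell $u$ of $\gamma$, $Q(\gamma,u)=\prod q(\varepsilon,u)$ over edges $\varepsilon$ containing $u$ and not in $\gamma$, and $Q^*(\gamma)=\prod_{0<i<n}Q(\gamma,x_i)$. For $X,Y\subseteq A\setminus A_0$, $I(X,Y)=\sum_{(\alpha,\beta)\in X\times Y,\ \alpha\ne\beta}Q^*(\gamma_{\alpha,\beta})f(\alpha)f(\beta)$. For $X\subseteq A\setminus A_0$, with $X^c=(A\setminus A_0)\setminus X$, $\mathfrak{M}(\mathcal{T},X)=\sum_{\alpha\in X}\big(1-\tfrac{1}{f(\alpha)}\big)I(\{\alpha\},X^c)$.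 A pseudo-root of $(V,A,E,f,q)$ is a vertex $v_0$ such that $q(e,v_0)=1$ for all edges $e$ containing $v_0$, and for every $v\in V\setminus\{v_0\}$ at most one edge $e$ containing $v$ and not in $\gamma_{v_0,v}$ satisfies $q(e,v)\ne1$. A decorated pseudo-rooted tree is $(V,A,E,f,q,v_0)$ with $(V,A,E,f,q)$ a decorated tree and $v_0$ a pseudo-root; $M$ etc. are those of $(V,A,E,f,q)$. For nonempty $X\subseteq A\setminus A_0$, $\mathcal{T}_X$ is defined as follows. Let $\mathcal{T}'_X$ have arrow set $X$, vertex set the vertices of $\mathcal{T}$ lying on $\gamma_{v_0,\alpha}$ for some $\alpha\in X$, edge set the edges of $\mathcal{T}$ lying in $\gamma_{v_0,\alpha}$ for some $\alpha\in X$, with decorations as in $\mathcal{T}$. For each vertex $v$ of $\mathcal{T}'_X$ let $b_v=\prod q(e,v)$ over edges $e$ of $\mathcal{T}$ containing $v$ that are not edges of $\mathcal{T}'_X$. For each such $v$ with $b_v\ne1$, add a new arrow $\alpha_v$ with $f(\alpha_v)=0$ and an edge $\{v,\alpha_v\}$ decorated $b_v$ near $v$ and $1$ near $\alpha_v$. The result, with pseudo-root $v_0$, is $\mathcal{T}_X$; and $\mathcal{T}_\alpha:=\mathcal{T}_{\{\alpha\}}$. Partitions consist of nonempty sets. *)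

(* Defs.v *)
From Stdlib Require Import ClassicalEpsilon.
From mathcomp Require Import all_boot all_order all_algebra.
Set Implicit Arguments. Unset Strict Implicit. Unset Printing Implicit Defensive.
Import Order.TTheory GRing.Theory Num.Theory.
Local Open Scope ring_scope.

(* A (candidate) decorated tree whose cells live in a finite type T:
   V = vertices, A = arrows, E = edges (2-element sets of cells),
   f = arrow decoration, q e x = decoration of edge e near cell x. *)
Record dtree (T : finType) := DTree {
  dV : {set T}; dA : {set T}; dE : {set {set T}};
  df : T -> int; dq : {set T} -> T -> int }.

Section Defs.
Variable T : finType.
Implicit Types (t : dtree T) (p : seq T).

Definition cells t : {set T} := dV t :|: dA t.

Definition pedges p : seq {set T} :=
  match p with [::] => [::] | x :: s => pairmap (fun a b => [set a; b]) x s end.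

Definition is_path t (x y : T) p : bool :=
  [&& p != [::], head y p == x, last x p == y, all (mem (cells t)) p,
      all (mem (dE t)) (pedges p) & uniq (pedges p)].

(* the path gamma_{x,y} (unique in a tree) *)
Definition gamma t (x y : T) : seq T :=
  epsilon (inhabits [:: x]) (fun p => is_path t x y p).

Definition is_tree t : Prop :=
  forall x y, x \in cells t -> y \in cells t -> exists! p, is_path t x y p.

Definition valency t (x : T) : nat := #|[set e in dE t | x \in e]|.

Definition decorated_tree t : Prop :=
  [disjoint dV t & dA t] /\
  [/\ (forall e, e \in dE t -> e \subset cells t /\ #|e| = 2%N),
      is_tree t,
      (forall a, a \in dA t -> valency t a = 1%N),
      (forall e a, e \in dE t -> a \in dA t -> a \in e -> dq t e a = 1) &
      (forall v e e', v \in dV t -> e \in dE t -> e' \in dE t -> e != e' ->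
          v \in e -> v \in e' -> coprimez (dq t e v) (dq t e' v))].

Definition pseudo_root t (v0 : T) : Prop :=
  [/\ v0 \in dV t,
      (forall e, e \in dE t -> v0 \in e -> dq t e v0 = 1) &
      (forall v, v \in dV t -> v != v0 ->
         #|[set e in dE t | [&& v \in e, e \notin pedges (gamma t v0 v)
                                 & dq t e v != 1]]| <= 1)%N].

Definition A0 t : {set T} := [set a in dA t | df t a == 0].
Definition Anz t : {set T} := dA t :\: A0 t.

Definition fr t (a : T) : rat := (df t a)%:~R.
Definition qr t (e : {set T}) (x : T) : rat := (dq t e x)%:~R.

Definition incident t (e : {set T}) p : bool :=
  [&& e \in dE t, e \notin pedges p & has (mem e) p].

(* x_{v,alpha}; q(e,gamma) := q(e,u) for the (first) cell u of gamma in e *)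
Definition xva t (v a : T) : rat :=
  let g := gamma t v a in
  fr t a * \prod_(e in dE t | incident t e g) qr t e (head v [seq u <- g | u \in e]).

Definition Nv t (v : T) : rat := \sum_(a in Anz t) xva t v a.

Definition Mt t : rat :=
  - \sum_(v in dV t :|: A0 t) Nv t v * ((valency t v)%:R - 2).

Definition Qg t p (u : T) : rat :=
  \prod_(e in dE t | (u \in e) && (e \notin pedges p)) qr t e u.
Definition Qstar t p : rat :=
  \prod_(u <- take (size p).-2 (behead p)) Qg t p u.

Definition II t (X Y : {set T}) : rat :=
  \sum_(a in X) \sum_(b in Y | b != a) Qstar t (gamma t a b) * fr t a * fr t b.

Definition frakM t (X : {set T}) : rat :=
  \sum_(a in X) (1 - (fr t a)^-1) * II t [set a] (Anz t :\: X).

(* The tree T_X (pseudo-root v0); cells live in T + T, new arrows alpha_v = inr v *)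
Section TX.
Variables (t : dtree T) (v0 : T) (X : {set T}).
Definition VX : {set T} :=
  [set v in dV t | [exists a in X, v \in gamma t v0 a]].
Definition EX : {set {set T}} :=
  [set e in dE t | [exists a in X, e \in pedges (gamma t v0 a)]].
Definition bv (v : T) : int :=
  \prod_(e in dE t | (v \in e) && (e \notin EX)) dq t e v.
Definition newV : {set T} := [set v in VX | bv v != 1].
Definition liftS (e : {set T}) : {set T + T} := [set (inl x : T + T) | x in e].
Definition TX : dtree (T + T)%type :=
  @DTree (T + T)%type
    (liftS VX)
    (liftS X :|: [set (inr v : T + T) | v in newV])
    ([set liftS e | e in EX] :|: [set [set (inl v : T + T); inr v] | v in newV])
    (fun c => match c with inl a => df t a | inr _ => 0 end)
    (fun e c => match c with
                | inl x => if e == [set (inl x : T + T); inr x] then bv x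
                           else dq t [set y | (inl y : T + T) \in e] x
                | inr _ => 1 end).
End TX.
End Defs.

(* Main.v *)
From Stdlib Require Import ClassicalEpsilon.
Require Import Defs.
From mathcomp Require Import all_boot all_order all_algebra.
From mathcomp Require Import ring.
Set Implicit Arguments. Unset Strict Implicit. Unset Printing Implicit Defensive.
Import Order.TTheory GRing.Theory Num.Theory.
Local Open Scope ring_scope.

(** Fix an arrow [a] and hang the tree from [a]. For a cell [x], let [B x] be the
    set of edges at [x] that do not lead to [a], and let [R x] be the product of
    the decorations incident to [gamma x a] at the cells other than [x]; thus
    [xva x a = f a * (\prod_(e in B x) q e x) * R x]. The edges [e] of [B x]
    correspond to the children [c] of [x], and
    [R c = (\prod_(e' in B x :\ e) q e' x) * R x]. Summing this over all children
    telescopes [\sum_(x != a) xva x a * (valency x - 2)] into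
    [f a * (\sum_(x != a) R x * D x - 1)], where
    [D x = (#|B x| - 1) * \prod_(B x) q - \sum_(e in B x) \prod_(B x :\ e) q + 1].
    The pseudo-root condition says that at most one edge at [x] has decoration
    different from 1, apart from the edge [h] towards [v0]; so [D x] vanishes when
    [h] is not in [B x], that is, when [x] is off [gamma v0 a], and is
    [(p - 1) * (b - 1)] otherwise, with [p = q h x] and [b] the product over the
    edges at [x] not on [gamma v0 a]. Hence the sum depends only on data along
    [gamma v0 a], which [TX t v0 X] shares with [t] for every [X] containing [a].
    The sum runs over all cells but [a], whereas [Mt] omits the nonzero arrows:
    this difference is a sum of [xva b a] over nonzero arrows [b], which accounts
    for the intersection numbers. *)

(** * Edges traversed by a sequence of cells *)

Section EdgeLists.
Variable T : finType.
Implicit Types (p s : seq T) (e : {set T}).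

Lemma pedges_cons x y s : pedges (x :: y :: s) = [set x; y] :: pedges (y :: s).
Proof. by []. Qed.

Lemma pedges_cat s1 x s2 :
  pedges (s1 ++ x :: s2) = pedges (rcons s1 x) ++ pedges (x :: s2).
Proof.
elim: s1 => [|y [|z s1] IH] //.
exact: (congr1 (cons _) IH).
Qed.

Lemma pedges_rev p : pedges (rev p) = rev (pedges p).
Proof.
elim: p => [|x [|y s] IH] //; rewrite pedges_cons [RHS]rev_cons -IH !rev_cons.
by rewrite -(cats1 _ x) cat_rcons pedges_cat -[RHS]cats1 /= setUC.
Qed.

Lemma mem_pedges p e u : e \in pedges p -> u \in e -> u \in p.
Proof.
elim: p => [|x [|y s] IH] //; rewrite pedges_cons inE => /predU1P[->|eP] ue.
  by case/set2P: ue => ->; rewrite !inE eqxx ?orbT.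
by rewrite inE IH ?orbT.
Qed.

Lemma uniq_pedges p : uniq p -> uniq (pedges p).
Proof.
elim: p => [|x [|y s] IH] //; rewrite cons_uniq => /andP[xP uP].
rewrite pedges_cons cons_uniq IH // andbT; apply: contra xP => eP.
by apply: mem_pedges eP _; rewrite set21.
Qed.

(** Since [x] does not recur, no edge after the first can contain it. *)
Lemma pedges_at_head x y s e :
  uniq [:: x, y & s] -> x \in e -> (e \in pedges [:: x, y & s]) = (e == [set x; y]).
Proof.
rewrite cons_uniq => /andP[xP _] xe; rewrite pedges_cons inE orbC.
by case: (boolP (_ \in pedges _)) => // /mem_pedges/(_ xe); rewrite (negPf xP).
Qed.

Lemma set2_other e x : #|e| = 2%N -> x \in e -> exists2 y, y != x & e = [set y; x].
Proof.
move=> e2 xe; have /cards1P[y Ey] : #|e :\ x| == 1%N.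
  by move: e2; rewrite (cardsD1 x e) xe add1n => -[->].
have: y \in e :\ x by rewrite Ey set11.
rewrite !inE => /andP[yx ye]; exists y => //.
by rewrite setUC -Ey setD1K.
Qed.

End EdgeLists.

Definition adj (T : finType) (t : dtree T) : rel T :=
  fun x y => [set x; y] \in dE t.

(** * The local identity that evaluates [D x] *)

Section Products.
Variables (I : finType) (q : I -> rat).
Implicit Types B C H : {set I}.

(** If all factors on [C] are 1, both sides equal [#|C|]. Otherwise let [e0] carry the exceptional
    factor: the full product is [q e0], the summand at [e0] is 1, and the other [#|C| - 1] summands
    are [q e0]. *)
Lemma prod_le1_neq1 C : (#|[set e in C | q e != 1%R]| <= 1)%N ->
  \sum_(e in C) \prod_(e' in C :\ e) q e' = (#|C|%:R - 1) * \prod_(e in C) q e + 1.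
Proof.
move=> C1; have [D0|[e0]] := set_0Vmem [set e in C | q e != 1].
  have q1 e : e \in C -> q e = 1.
    move=> eC; apply/eqP; apply: contraFT (in_set0 e) => ne.
    by rewrite -D0 inE eC.
  have -> : \prod_(e in C) q e = 1 by apply: big1.
  rewrite (eq_bigr (fun=> 1)) => [|e eC].
    by rewrite sumr_const; ring.
  by rewrite big1 // => e' /setD1P[_ /q1].
rewrite inE => /andP[e0C ne0].
have q1 e : e \in C -> e != e0 -> q e = 1.
  move=> eC nee; apply/eqP; apply: contraNT nee => ne; apply/eqP.
  by apply: (card_le1_eqP C1); rewrite inE ?eC ?e0C.
have pC : \prod_(e in C) q e = q e0.
  rewrite (big_setD1 e0) //= big1 ?mulr1 // => e /setD1P[ne eC]; exact: q1.
rewrite (big_setD1 e0) //= pC (big1 _ (fun i => i \in C :\ e0)); last first.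
  by move=> e /setD1P[ne eC]; apply: q1.
rewrite (eq_bigr (fun=> q e0)) => [|e /setD1P[ne eC]].
  by rewrite sumr_const (cardsD1 e0 C) e0C -mulr_natl natrD /=; ring.
rewrite (big_setD1 e0) ?inE ?e0C 1?eq_sym ?ne //= big1 ?mulr1 // => e'.
by rewrite !inE => /and3P[nee _ e'C]; apply: q1.
Qed.

(** If [B :&: H] is empty, both sides vanish by [prod_le1_neq1]. If it is [[set h]], let [n] be the
    size of [B :\: H] and [b] the product over it: splitting off [h] turns the left side into [n * q
    h * b - b - q h * ((n - 1) * b + 1) + 1], which factors. *)
Lemma prod_defect B H : (#|B :&: H| <= 1)%N ->
  (#|[set e in B :\: H | q e != 1%R]| <= 1)%N ->
  (#|B|%:R - 1) * \prod_(e in B) q e - \sum_(e in B) \prod_(e' in B :\ e) q e' + 1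
  = (\prod_(e in B :&: H) q e - 1) * (\prod_(e in B :\: H) q e - 1).
Proof.
move=> BH1 /prod_le1_neq1; set C := B :\: H => sC.
have [BH0|[h hBH]] := set_0Vmem (B :&: H).
  have BC : B = C by rewrite -(setID B H) BH0 set0U.
  by rewrite BH0 big_set0 {1 2 3 4}BC sC; ring.
have BHh : B :&: H = [set h].
  apply/setP=> e; rewrite in_set1; apply/idP/eqP => [eBH|->//].
  exact: (card_le1_eqP BH1).
have [hB hH] := setIP hBH.
have BDh : B :\ h = C by rewrite -BHh setDIr setDv set0U.
have hC : h \notin C by rewrite inE hH.
rewrite (big_setD1 h) //= [\sum_(e in B) _](big_setD1 h) //= BDh BHh big_set1.
rewrite [\sum_(e in C) _](eq_bigr (fun e => q h * \prod_(e' in C :\ e) q e')) => [|e eC].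
  by rewrite -mulr_sumr sC (cardsD1 h) hB BDh natrD /=; ring.
have he : h != e by apply: contraNneq hC => ->.
rewrite (big_setD1 h) ?inE ?he //=; congr (_ * _); apply: eq_bigl => e'.
by rewrite -BDh !inE; do !case: (_ == _); rewrite ?andbF.
Qed.

End Products.

(** * Paths in a tree *)

Section TreePaths.
Variables (T : finType) (t : dtree T).
Hypothesis edgeP : forall e, e \in dE t -> e \subset cells t /\ #|e| = 2%N.
Implicit Types (p s : seq T) (e : {set T}).

Lemma edge_cells e x : e \in dE t -> x \in e -> x \in cells t.
Proof. by move=> /edgeP[/subsetP H _]; apply: H. Qed.

Lemma is_path_cons x y z s :
  is_path t x y (z :: s) = [&& z == x, last z s == y, all (mem (cells t)) (z :: s),
     all (mem (dE t)) (pedges (z :: s)) & uniq (pedges (z :: s))].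
Proof. by []. Qed.

Lemma is_path_head x y p : is_path t x y p -> exists s, p = x :: s.
Proof. by case: p => // z s; rewrite is_path_cons => /andP[/eqP-> _]; exists s. Qed.

Lemma is_path_mem x y p : is_path t x y p -> (x \in p) && (y \in p).
Proof.
move=> pP; have [s Ep] := is_path_head pP; move: pP.
by rewrite Ep is_path_cons => /and3P[_ /eqP<- _]; rewrite mem_head mem_last.
Qed.

Lemma is_path_cells x y p u : is_path t x y p -> u \in p -> u \in cells t.
Proof. by case/and5P=> _ _ _ /allP H _ /H. Qed.

Lemma is_path_edge x y p e : is_path t x y p -> e \in pedges p -> e \in dE t.
Proof. by case/and5P=> _ _ _ _ /andP[/allP H _] /H. Qed.

Lemma is_path_pedges_uniq x y p : is_path t x y p -> uniq (pedges p).
Proof. by case/and5P=> _ _ _ _ /andP[]. Qed.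

Lemma is_path_id x : x \in cells t -> is_path t x x [:: x].
Proof. by move=> xC; rewrite is_path_cons /= xC !eqxx. Qed.

Lemma is_path_extend c x y p : is_path t x y p -> [set c; x] \in dE t ->
  [set c; x] \notin pedges p -> is_path t c y (c :: p).
Proof.
move=> pP; have [s Ep] := is_path_head pP; move: pP; rewrite Ep !is_path_cons.
case/and5P=> _ /= ls cC eE uE cxE cxN; rewrite eqxx ls cC cxE eE.
by rewrite (edge_cells cxE) ?set21 //= uE cxN.
Qed.

Lemma is_path_behead c y d s :
  is_path t c y [:: c, d & s] ->
  [/\ is_path t d y (d :: s), [set c; d] \in dE t & [set c; d] \notin pedges (d :: s)].
Proof.
rewrite !is_path_cons pedges_cons => /and5P[_ /= ls /andP[_ cC] /andP[cdE eE]].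
by rewrite eqxx ls cC eE; case/andP.
Qed.

Lemma is_path_suffix x y s1 u s2 :
  is_path t x y (s1 ++ u :: s2) -> is_path t u y (u :: s2).
Proof.
elim: s1 x => [|z [|w s1] IH] x pP.
- by have [s [Eu _]] := is_path_head pP; rewrite {1}Eu.
- by have [s [Eu _]] := is_path_head pP; move: pP; rewrite Eu => /is_path_behead[].
have [s [Eu _]] := is_path_head pP; move: pP; rewrite Eu => /is_path_behead[+ _ _].
exact: IH.
Qed.

Lemma is_path_rev x y p : is_path t x y p -> is_path t y x (rev p).
Proof.
case: p => // z s; rewrite is_path_cons => /and5P[/eqP-> /eqP ls cC eE uE].
rewrite /is_path pedges_rev rev_uniq uE !all_rev cC eE.
rewrite rev_cons last_rcons eqxx andbT /=.
by case: (lastP s) ls => [|s' w] /=; rewrite ?rev_rcons /= ?last_rcons => ->; rewrite eqxx.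
Qed.

Lemma is_path_prefix x y s1 u s2 :
  is_path t x y (s1 ++ u :: s2) -> is_path t x u (rcons s1 u).
Proof.
move/is_path_rev; rewrite rev_cat rev_cons cat_rcons => /is_path_suffix.
by move/is_path_rev; rewrite rev_cons revK.
Qed.

Lemma all_pedges_path z s :
  all (mem (dE t)) (pedges (z :: s)) = path (adj t) z s.
Proof. by elim: s z => //= w s IH z; rewrite -IH. Qed.

(** A walk can be shortened until its cells are distinct, and distinct cells force distinct
    edges. *)
Lemma connect_is_path x y : x \in cells t -> connect (adj t) x y ->
  exists p, is_path t x y p.
Proof.
move=> xC /connectP[p0 p0P ->]; case/shortenP: p0P => p pP pU _.
exists (x :: p); rewrite is_path_cons !eqxx all_pedges_path pP uniq_pedges //= andbT xC /=.
elim: p x xC pP {pU} => //= w s IH x xC /andP[xw sP].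
have wC: w \in cells t by apply: edge_cells xw _; rewrite set22.
by rewrite wC (IH w).
Qed.

Lemma adj_sym : symmetric (adj t).
Proof. by move=> x y; rewrite /adj setUC. Qed.

Hypothesis treeP : is_tree t.

Lemma gammaP x y : x \in cells t -> y \in cells t -> is_path t x y (gamma t x y).
Proof.
by move=> xC yC; have [p [pP _]] := treeP xC yC; 
apply: (epsilon_spec (inhabits [:: x]) (fun p => is_path t x y p)); exists p.
Qed.

(** As [gamma] is defined by choice, uniqueness of paths is what computes it: exhibiting any path
    with the right ends suffices. *)
Lemma gamma_eq x y p : is_path t x y p -> gamma t x y = p.
Proof.
move=> pP; have /andP[/(is_path_cells pP) xC /(is_path_cells pP) yC] := is_path_mem pP.
have [p' [_ U]] := treeP xC yC.
by rewrite -(U _ pP) -(U _ (gammaP xC yC)).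
Qed.

Lemma is_path_unique x y p p' : is_path t x y p -> is_path t x y p' -> p = p'.
Proof. by move=> /gamma_eq <- /gamma_eq. Qed.

(** By definition a path only avoids repeated edges. If its first cell recurred, the part from the
    second occurrence on would be a shorter path with the same ends. *)
Lemma is_path_uniq x y p : is_path t x y p -> uniq p.
Proof.
elim: p x => // z s IH x pP; have [_ [Ez _]] := is_path_head pP; subst z.
rewrite cons_uniq; apply/andP; split; last first.
  by case: s pP IH => // w s /is_path_behead[pP _ _] IH; apply: IH pP.
apply/negP=> xs; case/splitPr: xs pP => s1 s2 pP.
have := is_path_unique pP (is_path_suffix (s1 := x :: s1) pP).
by case=> /(congr1 size)/eqP; rewrite size_cat /= addnS -addSn -[X in _ == X]add0n eqn_add2r.
Qed.

Lemma gamma_rev x y : x \in cells t -> y \in cells t ->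
  gamma t y x = rev (gamma t x y).
Proof. by move=> xC yC; apply/gamma_eq/is_path_rev/gammaP. Qed.

Lemma gamma_id x : x \in cells t -> gamma t x x = [:: x].
Proof. by move=> xC; apply/gamma_eq/is_path_id. Qed.

Lemma gamma_step x a : x \in cells t -> a \in cells t -> x != a ->
  exists c, [/\ gamma t x a = x :: gamma t c a, [set x; c] \in dE t & c \in cells t].
Proof.
move=> xC aC xa; have pP := gammaP xC aC; have [s Es] := is_path_head pP.
move: pP; rewrite Es; case: s {Es} => [|c s].
  by rewrite is_path_cons /= (negPf xa) andbF.
move=> pP; have [sP ? _] := is_path_behead pP; exists c; rewrite (gamma_eq sP); split=> //.
by apply: (is_path_cells sP); rewrite mem_head.
Qed.

(** An edge off the path that joined two of its cells [x] and [w] could be put in front of the part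
    from [w] on; by uniqueness the path from [x] would then begin with that very edge. Hence the
    [head] in [xva] picks the only cell of the path on an incident edge. *)
Lemma size_cells_in_edge x y p e : is_path t x y p -> e \in dE t ->
  e \notin pedges p -> (size [seq u <- p | u \in e] <= 1)%N.
Proof.
elim: p x => // z s IH x pP eE eN; have [_ [Ez _]] := is_path_head pP; subst z.
rewrite /=; case: ifP => xe; last first.
  case: s pP eN IH => // w s /is_path_behead[pP _ _].
  by rewrite pedges_cons inE => /norP[_ eN] IH; apply: IH pP eE eN.
rewrite /= ltnS leqn0 size_filter -leqn0 leqNgt -has_count.
apply/hasPn=> w ws; apply/negP=> we.
have xNs : x \notin s by have /andP[] := is_path_uniq pP.
have Ee : e = [set x; w].
  have [_ e2] := edgeP eE.
  apply/esym/eqP; rewrite eqEcard e2 cards2 subUset !sub1set xe we /=.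
  by rewrite eq_sym (memPn xNs).
move: pP eN {xNs}; case/splitPr: ws => s1 s2 pP eN.
have P1 := is_path_suffix (s1 := x :: s1) pP.
have eN2 : e \notin pedges (w :: s2).
  by apply: contra eN; rewrite -cat_cons pedges_cat mem_cat => ->; rewrite orbT.
rewrite Ee in eE eN2; have [Es] := is_path_unique pP (is_path_extend P1 eE eN2).
by rewrite Es pedges_cons -Ee mem_head in eN.
Qed.

End TreePaths.

(** * The tree hung from [a] and the telescoping sum *)

Section PathSum.
Variables (T : finType) (t : dtree T).
Hypothesis edgeP : forall e, e \in dE t -> e \subset cells t /\ #|e| = 2%N.
Hypothesis treeP : is_tree t.
Variable a : T.
Hypothesis aC : a \in cells t.
Implicit Types (p s : seq T) (e : {set T}).

Local Notation g x := (gamma t x a).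

Let gP x : x \in cells t -> is_path t x a (g x).
Proof. by move=> xC; apply: gammaP. Qed.

Let g_uniq x : x \in cells t -> uniq (g x).
Proof. by move=> /gP/(is_path_uniq treeP). Qed.

(** This is [B x], the edges from [x] to its children; [tail_prod x] is [R x], and [path_prod x]
    also takes in the factor at [x] itself. *)
Definition branches x : {set {set T}} :=
  [set e in dE t | (x \in e) && (e \notin pedges (g x))].
Definition tail_prod x : rat := \prod_(u <- behead (g x)) Qg t (g x) u.
Definition path_prod x : rat := \prod_(u <- g x) Qg t (g x) u.

(** The factors [Qg] group the incident edges by the cell at which they meet the path, and by
    [size_cells_in_edge] each edge meets it only once. *)
Lemma xva_path_prod x : x \in cells t -> xva t x a = fr t a * path_prod x.
Proof.
move=> xC; rewrite /xva /path_prod; congr (_ * _); rewrite /Qg.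
rewrite (exchange_big_dep (mem (dE t))) /=; last by move=> u e _ /andP[].
rewrite big_mkcondr; apply: eq_bigr => e eE; rewrite /incident eE /=.
case: (boolP (e \in _)) => eN /=.
  by rewrite big1_seq // => u; rewrite andbF.
transitivity (\prod_(u <- [seq u <- g x | u \in e]) qr t e u); last first.
  by rewrite big_filter; apply: eq_bigl => u; rewrite andbT.
rewrite has_filter -[[seq u <- g x | mem e u]]/[seq u <- g x | u \in e].
have := size_cells_in_edge edgeP treeP (gP xC) eE eN.
by case: [seq u <- g x | u \in e] => [|u []] //= _; rewrite ?big_nil ?big_seq1.
Qed.

Lemma path_prodE x : x \in cells t ->
  path_prod x = (\prod_(e in branches x) qr t e x) * tail_prod x.
Proof.
move=> xC; rewrite /path_prod /tail_prod; have [s Es] := is_path_head (gP xC).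
rewrite Es big_cons /=; congr (_ * _); apply: eq_bigl => e.
by rewrite inE Es.
Qed.

(** The one edge at [x] that is not a branch is the first edge of the path to [a]. *)
Lemma valency_branches x : x \in cells t -> x != a -> valency t x = #|branches x|.+1.
Proof.
move=> xC xa; have [c [Eg xcE cC]] := gamma_step treeP xC aC xa.
have [s Es] := is_path_head (gP cC); rewrite Es in Eg.
have gU : uniq [:: x, c & s] by rewrite -Eg g_uniq.
rewrite /valency; have <- : [set x; c] |: branches x = [set e in dE t | x \in e].
  apply/setP=> e; rewrite !inE Eg; case: (boolP (x \in e)) => [xe|xe]; last first.
    by rewrite !andbF orbF; apply: contraNF xe => /eqP->; rewrite set21.
  rewrite (pedges_at_head gU) //; case: eqP => [->|_] //=.
  by rewrite xcE.
by rewrite cardsU1 inE Eg (pedges_at_head gU) ?set21 // eqxx !andbF add1n.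
Qed.

Lemma branches_root : branches a = [set e in dE t | a \in e].
Proof. by apply/setP=> e; rewrite !inE gamma_id //= andbT. Qed.

(** The parent of [x] in the tree hung from [a]. The default value makes [a] its own parent, so
    children have to be taken with [c != a]. *)
Definition next_cell x := head a (behead (g x)).

Lemma next_cellP c : c \in cells t -> c != a ->
  [/\ next_cell c \in cells t, g c = c :: g (next_cell c), [set c; next_cell c] \in branches (next_cell c)
    & c != next_cell c].
Proof.
move=> cC ca; have [x [Eg cxE xC]] := gamma_step treeP cC aC ca.
have [s Es] := is_path_head (gP xC).
have Ex : next_cell c = x by rewrite /next_cell Eg Es.
rewrite Ex; have := gP cC; rewrite Eg Es => /is_path_behead[_ _ cxN].
split=> //; first by rewrite inE cxE set22 Es.
by have := g_uniq cC; rewrite Eg Es /= inE => /andP[/norP[]].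
Qed.

(** Put in front of [g x], a branch at [x] yields the path to [a] from its other end, whose parent
    is therefore [x]. *)
Lemma branchP x e : x \in cells t -> e \in branches x ->
  exists c, [/\ c \in cells t, c != a, next_cell c = x & e = [set c; x]].
Proof.
move=> xC; rewrite inE => /and3P[eE xe eN]; have [_ e2] := edgeP eE.
have [c cx Ee] := set2_other e2 xe; rewrite Ee in eE eN.
have cC : c \in cells t by apply: (edge_cells edgeP eE); rewrite set21.
have Eg := gamma_eq treeP (is_path_extend edgeP (gP xC) eE eN).
have [s Es] := is_path_head (gP xC).
exists c; split=> //; last by rewrite /next_cell Eg Es.
by apply/eqP=> Ec; move: Eg; rewrite Ec gamma_id // Es.
Qed.

(** Passing from [g x] to [g c] puts the edge [[set c; x]] on the path. Among the cells after [c]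
    only [x] lies on it, so only the factor at [x] loses an edge. *)
Lemma tail_prod_child x c : x \in cells t -> c \in cells t -> c != a -> next_cell c = x ->
  tail_prod c = (\prod_(e in branches x :\ [set c; x]) qr t e x) * tail_prod x.
Proof.
move=> xC cC ca Ex; have [_] := next_cellP cC ca; rewrite Ex => Eg _ cx.
rewrite /tail_prod Eg [behead (_ :: _)]/=.
have [s Es] := is_path_head (gP xC); rewrite Es big_cons [behead _]/=; congr (_ * _).
  apply: eq_bigl => e; rewrite pedges_cons inE negb_or !inE Es.
  by case: (_ == _); rewrite /= ?andbF.
apply: eq_big_seq => u us; apply: eq_bigl => e.
rewrite pedges_cons inE; case: (boolP (u \in e)) => //= ue.
case: eqP ue => // -> /set2P[] Eu; subst u.
  by have := g_uniq cC; rewrite Eg Es /= inE us orbT.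
by have := g_uniq xC; rewrite Es /= us.
Qed.

(** The cells other than [a] are grouped by parent, and the children [c] of [x] are matched with the
    branches [[set c; x]]. *)
Lemma sum_tail_prod :
  \sum_(c in cells t | c != a) tail_prod c =
  \sum_(x in cells t) (\sum_(e in branches x) \prod_(e' in branches x :\ e) qr t e' x)
     * tail_prod x.
Proof.
rewrite (partition_big next_cell (mem (cells t))) /=; last first.
  by move=> c /andP[cC ca]; have [] := next_cellP cC ca.
apply: eq_bigr => x xC; rewrite mulr_suml.
pose ch := [set c in cells t | (c != a) && (next_cell c == x)].
have Bx : branches x = [set [set c; x] | c in ch].
  apply/setP=> e; apply/idP/imsetP => [/(branchP xC)[c [cC ca cx Ee]]|[c]].
    by exists c; rewrite // inE cC ca cx eqxx.
  by rewrite inE => /and3P[cC ca /eqP<-] ->; have [] := next_cellP cC ca.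
(* Only the index set of the outer sum is rewritten: the inner products keep [branches x], as
   [tail_prod_child] expects. *)
rewrite [RHS](eq_bigl _ _ (fun e => congr1 (fun B : {set {set T}} => e \in B) Bx)).
rewrite big_imset => [|c c'] /=.
  apply: eq_big => [c|c]; first by rewrite /ch in_set andbA.
  by case/andP=> /andP[cC ca] /eqP cx; apply: tail_prod_child.
rewrite /ch in_set => /and3P[cC ca /eqP Ex] _ /setP/(_ c); rewrite set21.
have [_ _ _] := next_cellP cC ca; rewrite Ex => cx /esym/set2P[//|Ec].
by rewrite Ec eqxx in cx.
Qed.

(** The terms added to each summand are those of [sum_tail_prod], whose two sides, restricted to
    [x != a], differ by the term at [a]. That term is 1 because an arrow has a single branch; this
    is the constant subtracted at the end. *)
Lemma sum_path_prod : valency t a = 1%N ->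
  \sum_(x in cells t | x != a) path_prod x * ((valency t x)%:R - 2) =
  \sum_(x in cells t | x != a)
    tail_prod x * ((#|branches x|%:R - 1) * \prod_(e in branches x) qr t e x
      - \sum_(e in branches x) \prod_(e' in branches x :\ e) qr t e' x + 1) - 1.
Proof.
move=> va; have E := sum_tail_prod; rewrite [RHS](bigD1 a) //= in E.
have Ea : (\sum_(e in branches a) \prod_(e' in branches a :\ e) qr t e' a)
   * tail_prod a = 1.
  rewrite /tail_prod gamma_id // big_nil mulr1.
  have /eqP/cards1P[e ->] : #|branches a| = 1%N by rewrite branches_root.
  by rewrite big_set1 setDv big_set0.
rewrite {}Ea in E; rewrite [X in _ = X - 1](eq_bigr (fun x => path_prod x *
    ((valency t x)%:R - 2) - (\sum_(e in branches x) \prod_(e' in branches x :\ e)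
       qr t e' x) * tail_prod x + tail_prod x)) => [|x /andP[xC xa]].
  by rewrite big_split sumrB /= E; ring.
by rewrite path_prodE // valency_branches // -natr1; ring.
Qed.

(** * Localization along the path from the pseudo-root *)

Section Root.
Variable v0 : T.
Hypothesis v0C : v0 \in cells t.
Hypothesis rootP : forall x, x \in cells t ->
  (#|[set e in dE t | [&& x \in e, e \notin pedges (gamma t v0 x) & dq t e x != 1%R]]|
     <= 1)%N.

Local Notation G := (gamma t v0 a).

(** A path from [v0] that enters [x] from a child [c] has been moving towards [a] all along, so the
    path to [a] continues it. In the induction, the cell [d] before [c] differs from [x], hence is a
    child of [c], and the claim holds for [c] and [d]. *)
Lemma gamma_cat_branch x s c : x \in cells t -> c \in cells t -> c != a -> next_cell c = x ->
  is_path t v0 x (rcons (rcons s c) x) -> G = s ++ c :: g x.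
Proof.
elim/last_ind: s x c => [|s d IH] x c xC cC ca Ex pP.
  have [_ [<- _]] := is_path_head pP; rewrite /=.
  by have [_ -> _ _] := next_cellP cC ca; rewrite Ex.
have [_ Eg _ _] := next_cellP cC ca; rewrite Ex in Eg.
have := is_path_uniq treeP pP; rewrite !rcons_uniq !mem_rcons !inE !mem_rcons !inE.
case/and3P=> /norP[_ /norP[xd _]] /norP[cd _] _.
have dcP : is_path t d x [:: d; c; x].
  apply: (is_path_suffix (x := v0) (s1 := s)).
  by move: pP; rewrite -!cats1 -!catA.
have [_ dcE _] := is_path_behead dcP.
have dcN : [set d; c] \notin pedges (g c).
  have [s2 Es2] := is_path_head (gP xC); rewrite Es2 in Eg.
  rewrite Eg (@pedges_at_head _ c x) ?set22 -?Eg ?g_uniq //.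
  apply: contra xd => /eqP/setP/(_ d); rewrite set21 => /esym/set2P[Ed|->] //.
  by rewrite Ed eqxx in cd.
have Ed := gamma_eq treeP (is_path_extend edgeP (gP cC) dcE dcN).
rewrite (IH c d) ?Eg //.
- by rewrite -cats1 -catA.
- by apply: (edge_cells edgeP dcE); rewrite set21.
- by apply/eqP=> Eda; move: Ed; rewrite Eda gamma_id // Eg.
- by rewrite /next_cell Ed Eg.
by apply: (is_path_prefix (y := x) (s2 := [:: x])); rewrite -cat_rcons cats1.
Qed.

(** Read backwards, the path starts at [x], and only its first edge contains [x]. *)
Lemma root_edge_unique x : x \in cells t ->
  (#|[set e in pedges (gamma t v0 x) | x \in e]| <= 1)%N.
Proof.
move=> xC; have [->|xv] := eqVneq x v0.
  by rewrite gamma_id //; apply/card_le1_eqP=> e; rewrite !inE.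
have [c [Eg _ cC]] := gamma_step treeP xC v0C xv.
have [s Es] := is_path_head (gammaP treeP cC v0C); rewrite Es in Eg.
have gU : uniq [:: x, c & s] by rewrite -Eg (is_path_uniq treeP (gammaP treeP xC v0C)).
rewrite (gamma_rev treeP xC v0C) Eg pedges_rev.
apply/card_le1_eqP=> e e'; rewrite !inE !mem_rev => /andP[+ xe] /andP[+ xe'].
by rewrite !(pedges_at_head gU) // => /eqP-> /eqP->.
Qed.

(** The edge is the last one on the path from [v0] to [x]; being a branch it comes from a child of
    [x], so [gamma_cat_branch] applies. *)
Lemma root_edge_branch x e : x \in cells t -> e \in branches x ->
  e \in pedges (gamma t v0 x) -> x \in G.
Proof.
move=> xC eB eR; have [c [cC ca Ex Ee]] := branchP xC eB.
have xe : x \in e by rewrite Ee set22.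
have xv : x != v0 by apply: contraTneq eR => ->; rewrite gamma_id.
have pP := gammaP treeP xC v0C; have [d [Eg _ dC]] := gamma_step treeP xC v0C xv.
have [s Es] := is_path_head (gammaP treeP dC v0C); rewrite Es in Eg.
have Er : gamma t v0 x = rcons (rcons (rev s) d) x.
  by rewrite (gamma_rev treeP xC v0C) Eg !rev_cons.
move: eR; rewrite (gamma_rev treeP xC v0C) pedges_rev mem_rev Eg pedges_at_head //.
  rewrite Ee => /eqP/setP/(_ c); rewrite set21 => /esym/set2P[Ec|Ec].
    by have [_ _ _] := next_cellP cC ca; rewrite Ex Ec eqxx.
  have := gammaP treeP v0C xC; rewrite Er -Ec => /(gamma_cat_branch xC cC ca Ex) ->.
  have [s' ->] := is_path_head (gP xC).
  by rewrite mem_cat !inE eqxx !orbT.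
by rewrite -Eg (is_path_uniq treeP pP).
Qed.

Lemma path_sum : valency t a = 1%N ->
  \sum_(x in cells t | x != a) path_prod x * ((valency t x)%:R - 2) =
  \sum_(x <- G | x != a) (\prod_(u <- behead (g x)) Qg t G u)
    * ((\prod_(e <- pedges (gamma t v0 x) | x \in e) qr t e x - 1) * (Qg t G x - 1)) - 1.
Proof.
move=> va; rewrite sum_path_prod //; congr (_ - 1).
have GP := gammaP treeP v0C aC.
rewrite [RHS]big_mkcond big_uniq ?(is_path_uniq treeP GP) //= -big_mkcondr /=.
pose H x := [set e in pedges (gamma t v0 x)].
have defect x : x \in cells t -> (#|branches x|%:R - 1) * \prod_(e in branches x) qr t e x
      - \sum_(e in branches x) \prod_(e' in branches x :\ e) qr t e' x + 1
    = (\prod_(e in branches x :&: H x) qr t e x - 1)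
      * (\prod_(e in branches x :\: H x) qr t e x - 1).
  move=> xC; apply: prod_defect.
    apply: leq_trans (root_edge_unique xC); apply/subset_leq_card/subsetP=> e.
    by rewrite !inE => /andP[/and3P[_ -> _] ->].
  apply: leq_trans (rootP xC); apply/subset_leq_card/subsetP=> e.
  by rewrite !inE /qr (eqr_int _ _ 1) => /andP[/andP[-> /and3P[-> -> _]] ->].
(* Off [G] the edge towards [v0] is not a branch, so the first factor of the defect is an empty
   product minus 1. *)
rewrite (bigID (fun x => x \in G)) /= [X in _ + X]big1 ?addr0; last first.
  move=> x /andP[/andP[xC xa] xG]; rewrite defect //.
  suff -> : branches x :&: H x = set0 by rewrite big_set0 subrr mul0r mulr0.
  apply/setP=> e; rewrite in_set0; apply: contraNF xG => /setIP[eB].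
  by rewrite inE; apply: root_edge_branch eB.
apply: eq_big => [x|x /andP[/andP[xC xa] xG]].
  rewrite andbAC andbC [RHS]andbC; congr (_ && _).
  by case: (boolP (x \in G)) => xG; rewrite ?andbF // andbT (is_path_cells GP).
(* Cutting [G] at [x] gives [gamma t v0 x] and [g x], which share no edge; this identifies each of
   the three products. *)
rewrite defect //; move: GP; case/splitPr EG: {1}_ / xG => [s1 s2] GP.
have GU := is_path_uniq treeP GP; have GE := is_path_pedges_uniq GP.
have Eg := gamma_eq treeP (is_path_suffix GP).
have Ev := gamma_eq treeP (is_path_prefix GP).
rewrite pedges_cat cat_uniq in GE; case/and3P: GE => RU /hasPn RN _.
congr (_ * ((_ - 1) * (_ - 1))).
- rewrite /tail_prod Eg /= EG; apply: eq_big_seq => u us; apply: eq_bigl => e.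
  rewrite pedges_cat mem_cat negb_or; case: (boolP (u \in e)) => //= ue.
  suff -> : e \notin pedges (rcons s1 x) by [].
  apply/negP=> /mem_pedges/(_ ue).
  move: GU; rewrite -cat_rcons cat_uniq => /and3P[_ /hasPn/(_ u us) /= + _] => /negP; exact.
- rewrite -[RHS]big_filter [RHS]big_uniq ?filter_uniq ?Ev //; apply: eq_bigl => e.
  rewrite !inE mem_filter Ev Eg andbC.
  case: (boolP (e \in pedges (rcons s1 x))) => [eR|_] /=; last by rewrite andbF.
  have -> : e \in dE t by apply: (is_path_edge (is_path_prefix GP)).
  have -> : e \notin pedges (x :: s2) by apply: contraL eR => /RN.
  by rewrite andbT.
rewrite /Qg; apply: eq_bigl => e; rewrite !inE Ev Eg EG pedges_cat mem_cat.
by rewrite negb_or; do !case: (_ \in _).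
Qed.

End Root.

End PathSum.

(** * Embedding edges and paths into [T + T] *)

Section Lift.
Variable T : finType.
Implicit Types e : {set T}.

Lemma liftS_inl e x : (inl x \in liftS e) = (x \in e).
Proof. by rewrite /liftS mem_imset // => u v []. Qed.

Lemma liftS_inr e v : (inr v \in liftS e) = false.
Proof. by apply/imsetP=> -[]. Qed.

Lemma liftS_inj : injective (@liftS T).
Proof. by move=> e e' E; apply/setP=> x; rewrite -!liftS_inl E. Qed.

Lemma liftS2 (x y : T) : liftS [set x; y] = [set inl x; inl y].
Proof. by rewrite /liftS imsetU1 imset_set1. Qed.

Lemma liftSK e : [set y | (inl y : T + T) \in liftS e] = e.
Proof. by apply/setP=> y; rewrite inE liftS_inl. Qed.

Lemma pedges_map_inl (p : seq T) :
  pedges [seq (inl x : T + T) | x <- p] = [seq liftS e | e <- pedges p].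
Proof. by elim: p => [|x [|y s] IH] //=; rewrite -liftS2; congr (_ :: _). Qed.

End Lift.

(** * The tree [TX] and its paths *)

Section SubTree.
Variables (T : finType) (t : dtree T) (v0 : T) (X : {set T}).
Hypothesis VA : [disjoint dV t & dA t].
Hypothesis edgeP : forall e, e \in dE t -> e \subset cells t /\ #|e| = 2%N.
Hypothesis treeP : is_tree t.
Hypothesis arrowP : forall a, a \in dA t -> valency t a = 1%N.
Hypothesis v0V : v0 \in dV t.
Hypothesis rootP : forall x, x \in cells t ->
  (#|[set e in dE t | [&& x \in e, e \notin pedges (gamma t v0 x) & dq t e x != 1%R]]|
     <= 1)%N.
Hypothesis XA : X \subset dA t.
Hypothesis X0 : X != set0.

Local Notation tX := (TX t v0 X).

Let v0C : v0 \in cells t.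
Proof. by rewrite inE v0V. Qed.

Let XC a : a \in X -> a \in cells t.
Proof. by move=> aX; rewrite inE (subsetP XA) ?orbT. Qed.

Let GP a : a \in X -> is_path t v0 a (gamma t v0 a).
Proof. by move=> aX; apply: gammaP => //; apply: XC. Qed.

(** An arrow strictly inside the path would be entered and left by its only edge, but a path repeats
    no edge. *)
Lemma arrow_in_gamma a x : a \in cells t -> x \in dA t -> x \in gamma t v0 a -> x = a.
Proof.
move=> aC xA xG; apply/eqP; apply: contraT => xa.
have xC : x \in cells t by rewrite inE xA orbT.
have xv : x != v0 by apply: contraTneq xA => ->; rewrite (disjointFr VA).
have [c [Ec cE cC]] := gamma_step treeP xC v0C xv.
have [d [Ed dE' dC]] := gamma_step treeP xC aC xa.
have Ecd : [set x; c] = [set x; d].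
  have /eq_leq/card_le1_eqP := arrowP xA.
  by apply; rewrite inE ?cE ?dE' set21.
have cR : [set x; c] \in pedges (gamma t v0 x).
  rewrite (gamma_rev treeP xC v0C) pedges_rev mem_rev Ec.
  by have [s ->] := is_path_head (gammaP treeP cC v0C); rewrite mem_head.
have dR : [set x; d] \in pedges (gamma t x a).
  by rewrite Ed; have [s ->] := is_path_head (gammaP treeP dC aC); rewrite mem_head.
have := gammaP treeP v0C aC; case/splitPr: xG => s1 s2 pP.
rewrite (gamma_eq treeP (is_path_suffix pP)) -Ecd in dR.
rewrite (gamma_eq treeP (is_path_prefix pP)) in cR.
have := is_path_pedges_uniq pP; rewrite pedges_cat cat_uniq => /and3P[_ /hasPn/(_ _ dR)].
by rewrite /= cR.
Qed.

(** A cell on one of these paths is a vertex or, by [arrow_in_gamma], the final arrow. *)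
Lemma skeletonP x : reflect (exists2 a, a \in X & x \in gamma t v0 a)
                            (x \in VX t v0 X :|: X).
Proof.
apply: (iffP idP) => [|[a aX xG]].
  rewrite !inE => /orP[/andP[_ /exists_inP[a aX xG]]|xX]; first by exists a.
  by exists x => //; have /andP[] := is_path_mem (GP xX).
have := is_path_cells (GP aX) xG; rewrite !inE => /orP[->|xA].
  by apply/orP; left; apply/exists_inP; exists a.
by rewrite (arrow_in_gamma (XC aX) xA xG) aX orbT.
Qed.

Lemma skeleton_cells x : x \in VX t v0 X :|: X -> x \in cells t.
Proof. by case/skeletonP=> a aX; apply: is_path_cells (GP aX). Qed.

Lemma EXP e : reflect (exists2 a, a \in X & e \in pedges (gamma t v0 a)) (e \in EX t v0 X).
Proof.
rewrite inE; apply: (iffP andP) => [[_ /exists_inP]|[a aX eG]] //.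
by rewrite (is_path_edge (GP aX)) //; split=> //; apply/exists_inP; exists a.
Qed.

Lemma EX_skeleton e x : e \in EX t v0 X -> x \in e -> x \in VX t v0 X :|: X.
Proof.
by case/EXP=> a aX eG xe; apply/skeletonP; exists a => //; apply: mem_pedges eG xe.
Qed.

Lemma EX_edge e : e \in EX t v0 X -> e \in dE t.
Proof. by rewrite inE => /andP[]. Qed.

Lemma TX_edgeP e : reflect
  ((exists2 e0, e0 \in EX t v0 X & e = liftS e0) \/
   (exists2 v, v \in newV t v0 X & e = [set inl v; inr v]))
  (e \in dE tX).
Proof.
rewrite inE; apply: (iffP orP) => -[] H; [left|right|left|right].
- by case/imsetP: H => e0 ? ->; exists e0.
- by case/imsetP: H => v ? ->; exists v.
- by case: H => e0 ? ->; apply: imset_f.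
by case: H => v ? ->; apply: (imset_f (fun v => [set inl v; inr v])).
Qed.

Lemma TX_cells_inl x : (inl x \in cells tX) = (x \in VX t v0 X :|: X).
Proof.
rewrite /cells /= 2!in_setU !liftS_inl in_setU; congr (_ || _).
suff -> : (inl x \in [set inr v | v in newV t v0 X]) = false by rewrite orbF liftS_inl.
by apply/imsetP=> -[].
Qed.

Lemma TX_cells_inr v : (inr v \in cells tX) = (v \in newV t v0 X).
Proof.
rewrite /cells /= 2!in_setU !liftS_inr /= mem_imset //.
by move=> x y [].
Qed.

Lemma newV_skeleton v : v \in newV t v0 X -> v \in VX t v0 X.
Proof. by rewrite inE => /andP[]. Qed.

Lemma TX_edge_cells e : e \in dE tX -> e \subset cells tX /\ #|e| = 2%N.
Proof.
case/TX_edgeP=> [[e0 e0X ->]|[v vN ->]].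
  split; last first.
    by rewrite card_imset => [|x y [] //]; have [] := edgeP (EX_edge e0X).
  apply/subsetP=> -[x|v]; rewrite ?liftS_inr // liftS_inl TX_cells_inl.
  exact: EX_skeleton.
rewrite cards2; split=> //; rewrite subUset !sub1set TX_cells_inl TX_cells_inr vN andbT.
by rewrite inE newV_skeleton.
Qed.

Lemma TX_lift_edge e : (liftS e \in dE tX) = (e \in EX t v0 X).
Proof.
apply/TX_edgeP/idP => [[[e0 e0X /liftS_inj->]|[v _ /setP/(_ (inr v))]]|eX] //.
  by rewrite set22 liftS_inr.
by left; exists e.
Qed.

Lemma TX_inr_edge v e : e \in dE tX -> inr v \in e ->
  v \in newV t v0 X /\ e = [set inl v; inr v].
Proof.
case/TX_edgeP=> [[e0 _ ->]|[w wN ->]]; first by rewrite liftS_inr.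
by case/set2P=> // -[->].
Qed.

(** A path between old cells cannot visit a new arrow, since it would have to leave by the edge it
    came from. *)
Lemma TX_path_inl x y p : is_path tX (inl x) (inl y) p ->
  exists2 p', p = [seq inl u | u <- p'] & is_path t x y p'.
Proof.
move=> pP; have [p' Ep] : exists p', p = [seq inl u | u <- p'].
  elim: p x pP => // c s IH x pP; have [_ [Ec _]] := is_path_head pP; subst c.
  case: s IH pP => [|[z|v] s] IH pP; first by exists [:: x].
    by have [sP _ _] := is_path_behead pP; have [s' ->] := IH z sP; exists (x :: s').
  have [sP xvE xvN] := is_path_behead pP.
  have [_ Ev] := TX_inr_edge xvE (set22 _ _).
  case: s sP xvN {IH pP} => [|c s] sP; first by have /and3P[_ _ /andP[]] := sP.
  have [_ vcE _] := is_path_behead sP; have [_ Ec] := TX_inr_edge vcE (set21 _ _).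
  by rewrite pedges_cons Ev Ec mem_head.
exists p' => //; move: pP; rewrite Ep; case: p' {Ep} => // z s.
rewrite map_cons !is_path_cons -map_cons pedges_map_inl => /and5P[/eqP[->] ls cC eE uE].
move: ls; rewrite last_map => /eqP[->].
rewrite !eqxx -(map_inj_uniq (@liftS_inj _)) uE andbT /=; apply/andP; split.
  move/allP: cC => cC; apply/andP; split.
    by apply: skeleton_cells; rewrite -TX_cells_inl; apply: cC; rewrite mem_head.
  apply/allP=> u us; apply: skeleton_cells; rewrite -TX_cells_inl; apply: cC.
  by rewrite inE map_f ?orbT.
apply/allP=> e ep; apply: EX_edge; rewrite -TX_lift_edge; move/allP: eE; apply.
exact: map_f.
Qed.

Lemma TX_path_inr v y p : is_path tX (inr v) y p ->
  y = inr v /\ p = [:: inr v] \/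
  exists2 p', p = inr v :: p' & is_path tX (inl v) y p'.
Proof.
move=> pP; have [s Es] := is_path_head pP; subst p; case: s pP => [|c s] pP.
  by left; have /and3P[_ _ /andP[/eqP]] := pP.
have [sP vcE _] := is_path_behead pP; have [_ Ec] := TX_inr_edge vcE (set21 _ _).
have : inl v \in [set inr v; c] by rewrite Ec set21.
by case/set2P=> // Ev; right; exists (c :: s) => //; rewrite Ev.
Qed.

(** For old end cells this is uniqueness in [t]. A new arrow at the start is stripped by
    [TX_path_inr], and one at the end by reversing the path. *)
Lemma TX_path_unique x y p p' : is_path tX x y p -> is_path tX x y p' -> p = p'.
Proof.
have U1 u w s s' : is_path tX (inl u) (inl w) s -> is_path tX (inl u) (inl w) s' -> s = s'.
  move=> /TX_path_inl[s1 -> s1P] /TX_path_inl[s2 -> s2P].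
  by rewrite (is_path_unique treeP s1P s2P).
have U2 u c s s' : is_path tX c (inl u) s -> is_path tX c (inl u) s' -> s = s'.
  case: c => [w|v]; first exact: U1.
  case/TX_path_inr=> [[]|[s1 -> s1P]] //; case/TX_path_inr=> [[]|[s2 -> s2P]] //.
  by rewrite (U1 _ _ _ _ s1P s2P).
have U3 u c s s' : is_path tX (inl u) c s -> is_path tX (inl u) c s' -> s = s'.
  by move=> /is_path_rev sP /is_path_rev s'P; rewrite -[s]revK (U2 _ _ _ _ sP s'P) revK.
(* A nontrivial closed path at a new arrow would use its only edge twice. *)
have no_loop v s : is_path tX (inr v) (inr v) (inr v :: s) -> s = [::].
  move=> vP; case/TX_path_inr: (vP) => [[_ []] //|[s' [Es] s'P]]; subst s'.
  have vN : v \in newV t v0 X.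
    by rewrite -TX_cells_inr (is_path_cells vP) // mem_head.
  have vE : [set inl v; inr v] \in dE tX by apply/TX_edgeP; right; exists v.
  have vvP : is_path tX (inl v) (inr v) [:: inl v; inr v].
    apply: (is_path_extend TX_edge_cells (x := inr v)) => //.
    by apply: is_path_id; rewrite TX_cells_inr.
  move: (is_path_pedges_uniq vP); rewrite (U3 _ _ _ _ s'P vvP) /= setUC inE eqxx.
  by [].
case: x => [u|v]; first exact: U3.
move=> pP p'P; have [s Es] := is_path_head pP; have [s' Es'] := is_path_head p'P.
case/TX_path_inr: (pP) => [[Ey Ep]|[s1 Ep s1P]];
  case/TX_path_inr: (p'P) => [[Ey' Ep']|[s2 Ep' s2P]].
- by rewrite Ep Ep'.
- by rewrite Es' Ey in p'P *; rewrite (no_loop _ _ p'P) Ep.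
- by rewrite Es Ey' in pP *; rewrite (no_loop _ _ pP) Ep'.
by rewrite Ep Ep' (U3 _ _ _ _ s1P s2P).
Qed.

Lemma TX_connect c : c \in cells tX -> connect (adj tX) (inl v0) c.
Proof.
have C1 x : inl x \in cells tX -> connect (adj tX) (inl v0) (inl x).
  rewrite TX_cells_inl => /skeletonP[a aX xG].
  have pP := GP aX; have [s Es] := is_path_head pP; rewrite Es in xG.
  have sP : path (adj tX) (inl v0) [seq inl u | u <- s].
    rewrite -all_pedges_path -map_cons pedges_map_inl -Es; apply/allP=> _ /mapP[e eG ->].
    by rewrite [mem _ _]TX_lift_edge; apply/EXP; exists a.
  by apply: (path_connect sP); rewrite -map_cons; apply: map_f.
case: c => [x|v] cC; first exact: C1.
rewrite TX_cells_inr in cC; apply: (connect_trans (C1 v _)).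
  by rewrite TX_cells_inl inE newV_skeleton.
by apply: connect1; apply/TX_edgeP; right; exists v.
Qed.

Lemma TX_tree : is_tree tX.
Proof.
move=> x y xC yC; have [|p pP] := @connect_is_path _ tX TX_edge_cells x y xC.
  apply: connect_trans (TX_connect yC).
  by rewrite (sym_connect_sym (@adj_sym _ tX)) TX_connect.
by exists p; split=> // p'; apply: TX_path_unique.
Qed.

Lemma v0_skeleton : v0 \in VX t v0 X :|: X.
Proof.
have [a aX] := set0Pn _ X0; apply/skeletonP; exists a => //.
by have /andP[] := is_path_mem (GP aX).
Qed.

Lemma TX_gamma x y : x \in VX t v0 X :|: X -> y \in VX t v0 X :|: X ->
  gamma tX (inl x) (inl y) = [seq inl u | u <- gamma t x y].
Proof.
rewrite -!TX_cells_inl => xC yC.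
by have [p -> /(gamma_eq treeP)->] := TX_path_inl (gammaP TX_tree xC yC).
Qed.

(** The path from [x] to [y] inside [TX] projects to a path of [t], which by uniqueness is
    [gamma t x y]. *)
Lemma gamma_EX x y e : x \in VX t v0 X :|: X -> y \in VX t v0 X :|: X ->
  e \in pedges (gamma t x y) -> e \in EX t v0 X.
Proof.
move=> xS yS eG; rewrite -TX_lift_edge.
have xC := xS; have yC := yS; rewrite -TX_cells_inl in xC; rewrite -TX_cells_inl in yC.
apply: (is_path_edge (gammaP TX_tree xC yC)).
by rewrite TX_gamma // pedges_map_inl map_f.
Qed.

Lemma gamma_skeleton x y u : x \in VX t v0 X :|: X -> y \in VX t v0 X :|: X ->
  u \in gamma t x y -> u \in VX t v0 X :|: X.
Proof.
move=> xS yS uG; rewrite -TX_cells_inl.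
have xC := xS; have yC := yS; rewrite -TX_cells_inl in xC; rewrite -TX_cells_inl in yC.
apply: (is_path_cells (gammaP TX_tree xC yC)).
by rewrite TX_gamma // map_f.
Qed.

(** * Decorations, valencies and the pseudo-root condition in [TX] *)

Lemma dq_lift e x : dq tX (liftS e) (inl x) = dq t e x.
Proof.
rewrite /= liftSK; case: eqP => // /setP/(_ (inr x)).
by rewrite liftS_inr set22.
Qed.

Lemma qr_lift e x : qr tX (liftS e) (inl x) = qr t e x.
Proof. by rewrite /qr dq_lift. Qed.

(** The only edge at [a] is the last edge of [gamma t v0 a], so it is kept and the product is
    empty. *)
Lemma bv_arrow a : a \in X -> bv t v0 X a = 1.
Proof.
move=> aX; apply: big_pred0 => e; apply/negP=> /and3P[eE ae /negP]; apply.
have aA := subsetP XA _ aX; have aC := XC aX.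
have av : a != v0 by apply: contraTneq aA => ->; rewrite (disjointFr VA).
have [c [Ec cE cC]] := gamma_step treeP aC v0C av.
have -> : e = [set a; c].
  have /eq_leq/card_le1_eqP := arrowP aA.
  by apply; rewrite inE ?eE ?ae ?cE ?set21.
apply/EXP; exists a => //; rewrite (gamma_rev treeP aC v0C) pedges_rev mem_rev Ec.
by have [s ->] := is_path_head (gammaP treeP cC v0C); rewrite mem_head.
Qed.

(** The kept edges at [u] correspond under [liftS]. The pruned ones, all off [p], multiply to
    [bv t v0 X u], which is the decoration of the new edge. *)
Lemma TX_Qg p u : {subset pedges p <= EX t v0 X} -> u \in VX t v0 X :|: X ->
  Qg tX [seq inl w | w <- p] (inl u) = Qg t p u.
Proof.
move=> pX uS; rewrite /Qg (bigID (fun e => e \in [set liftS e0 | e0 in EX t v0 X])) /=.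
rewrite [RHS](bigID (fun e => e \in EX t v0 X)) /=; congr (_ * _).
  transitivity (\prod_(e in [set liftS e0 | e0 in EX t v0 X] |
      (inl u \in e) && (e \notin pedges [seq inl w | w <- p])) qr tX e (inl u)).
    apply: eq_bigl => e.
    case: (boolP (e \in [set liftS e0 | e0 in EX t v0 X])); last by rewrite andbF.
    by case/imsetP=> e0 e0X ->; rewrite TX_lift_edge e0X andbT.
  rewrite big_imset_cond /=; last by move=> e e' _ _; apply: liftS_inj.
  apply: eq_big => [e|e _]; last exact: qr_lift.
  rewrite liftS_inl pedges_map_inl mem_map; last exact: liftS_inj.
  by case: (boolP (e \in EX _ _ _)) => [/EX_edge->|]; rewrite ?andbT ?andbF.
transitivity ((bv t v0 X u)%:~R : rat); last first.
  rewrite rmorph_prod /=; apply: eq_bigl => e.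
  case: (boolP (e \in EX _ _ _)) => eX; rewrite ?andbF // !andbT.
  by rewrite (contra (pX e)) ?andbT.
have [uN|uN] := boolP (u \in newV t v0 X).
  rewrite (big_pred1 [set inl u; inr u]) => [|e].
    by rewrite /qr /= eqxx.
  apply/idP/eqP => [/andP[/and3P[/TX_edgeP[[e0 e0X ->]|[v vN ->]] ue _]]|->].
    by rewrite imset_f.
    by case/set2P: ue => // -[->].
  rewrite set21 pedges_map_inl; apply/andP; split; last first.
    by apply/imsetP=> -[e0 _ /setP/(_ (inr u))]; rewrite set22 liftS_inr.
  apply/and3P; split=> //; first by apply/TX_edgeP; right; exists u.
  by apply/mapP=> -[e0 _ /setP/(_ (inr u))]; rewrite set22 liftS_inr.
(* Without a new arrow at [u] the product in [tX] is empty, and [bv] is 1: by [bv_arrow] at an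
   arrow, by the definition of [newV] at a vertex. *)
rewrite big_pred0 => [|e].
  have -> // : bv t v0 X u = 1.
  have [uX|uX] := boolP (u \in X); first exact: bv_arrow.
  move: uS uN; rewrite in_setU (negPf uX) orbF [u \in newV _ _ _]inE => ->.
  by move/negPn/eqP.
apply/negP=> /andP[/and3P[/TX_edgeP[[e0 e0X ->]|[v vN ->]] ue _]].
  by rewrite imset_f.
by case/set2P: ue uN => // -[->]; rewrite vN.
Qed.

Lemma TX_path_prod a b : a \in VX t v0 X :|: X -> b \in VX t v0 X :|: X ->
  path_prod tX (inl a) (inl b) = path_prod t a b.
Proof.
move=> aS bS; rewrite /path_prod TX_gamma // big_map; apply: eq_big_seq => u uG.
by apply: TX_Qg => [e|]; [apply: gamma_EX | apply: gamma_skeleton uG].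
Qed.

Lemma TX_valency_inr v : v \in newV t v0 X -> valency tX (inr v) = 1%N.
Proof.
move=> vN; apply/eqP/cards1P; exists [set inl v; inr v]; apply/setP=> e.
rewrite in_set1 in_set; apply/andP/eqP => [[eE ve]|->]; first by have [] := TX_inr_edge eE ve.
by rewrite set22; split=> //; apply/TX_edgeP; right; exists v.
Qed.

Lemma TX_valency_inl a : a \in X -> valency tX (inl a) = 1%N.
Proof.
move=> aX; have aA := subsetP XA _ aX; apply/eqP; rewrite eqn_leq; apply/andP; split.
  have aN v : v \in newV t v0 X -> inl a \in [set inl v; inr v] -> False.
    move=> /newV_skeleton; rewrite inE => /andP[vV _] /set2P[] // -[Ea].
    by rewrite -Ea (disjointFl VA aA) in vV.
  apply/card_le1_eqP=> e e' /setIdP[eE ae] /setIdP[eE' ae'].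
  case/TX_edgeP: eE => [[e0 e0X Ee]|[v vN Ee]]; last by rewrite Ee in ae; case: (aN v).
  case/TX_edgeP: eE' => [[e1 e1X Ee']|[v vN Ee']]; last by rewrite Ee' in ae'; case: (aN v).
  rewrite {}Ee {}Ee' !liftS_inl in ae ae' *; congr (liftS _).
  have /eq_leq/card_le1_eqP := arrowP aA.
  by apply; rewrite inE ?ae ?ae' EX_edge.
have aC : inl a \in cells tX by rewrite TX_cells_inl inE aX orbT.
have vC : inl v0 \in cells tX by rewrite TX_cells_inl v0_skeleton.
have av : inl a != inl v0 :> T + T.
  by apply: contraTneq aA => -[->]; rewrite (disjointFr VA).
have [c [_ cE _]] := gamma_step TX_tree aC vC av.
by apply/card_gt0P; exists [set inl a; c]; rewrite inE cE set21.
Qed.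

(** A new edge at [x] stands for a pruned edge of [t] at [x] with decoration other than 1, since
    [bv] is not 1. This pruned edge is off the path from [v0], so it already exhausts the bound in
    [t] and no lifted edge can be counted besides. *)
Lemma TX_rootP x : x \in cells tX ->
  (#|[set e in dE tX | [&& x \in e, e \notin pedges (gamma tX (inl v0) x)
       & dq tX e x != 1%R]]| <= 1)%N.
Proof.
case: x => [x|v]; last first.
  rewrite TX_cells_inr => /TX_valency_inr <-; apply/subset_leq_card/subsetP=> e.
  by rewrite !in_set => /and3P[-> -> _].
rewrite TX_cells_inl => xS; rewrite TX_gamma ?v0_skeleton // pedges_map_inl.
have xC := skeleton_cells xS; have /card_le1_eqP xR := rootP xC.
have bX v : v \in newV t v0 X -> inl x \in [set inl v; inr v] -> v = x /\
    exists e, [/\ e \notin EX t v0 X & e \in [set e in dE t |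
      [&& x \in e, e \notin pedges (gamma t v0 x) & dq t e x != 1%R]]].
  move=> vN /set2P[] // -[Ev]; rewrite -Ev {v Ev} in vN *; split=> //.
  have [/existsP[e /andP[eX eR]]|] := boolP [exists e, (e \notin EX t v0 X) &&
      (e \in [set e in dE t | [&& x \in e, e \notin pedges (gamma t v0 x)
                                & dq t e x != 1%R]])]; first by exists e.
  rewrite negb_exists => /forallP bx; move: vN; rewrite inE => /andP[_ /eqP[]].
  apply: big1 => e /and3P[eE xe eX]; apply/eqP; apply: contraT => qe; have := bx e.
  rewrite eX in_set eE xe qe andbT /= negbK => eR.
  by rewrite (gamma_EX v0_skeleton xS eR) in eX.
apply/card_le1_eqP=> e e' /setIdP[eE /and3P[xe eR qe]] /setIdP[eE' /and3P[xe' eR' qe']].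
case/TX_edgeP: eE => [[e0 e0X Ee]|[v vN Ee]]; case/TX_edgeP: eE' => [[e1 e1X Ee']|[w wN Ee']].
- subst e e'; congr (liftS _); rewrite !liftS_inl !dq_lift in xe xe' qe qe'.
  rewrite !(mem_map (@liftS_inj _)) in eR eR'.
  by apply: xR; rewrite in_set ?EX_edge ?xe ?xe' ?eR ?eR'.
- subst e e'; have [_ [e [eX eR0]]] := bX _ wN xe'; rewrite liftS_inl dq_lift in xe qe.
  rewrite (mem_map (@liftS_inj _)) in eR; case/negP: eX.
  by rewrite (xR e0 e) // in_set EX_edge ?xe ?eR.
- subst e e'; have [_ [e [eX eR0]]] := bX _ vN xe; rewrite liftS_inl dq_lift in xe' qe'.
  rewrite (mem_map (@liftS_inj _)) in eR'; case/negP: eX.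
  by rewrite (xR e1 e) // in_set EX_edge ?xe' ?eR'.
by subst e e'; have [-> _] := bX _ vN xe; have [-> _] := bX _ wN xe'.
Qed.

(** After [path_sum] on both sides only data along [gamma t v0 a] remain, and these agree by
    [TX_gamma] and [TX_Qg]. *)
Lemma TX_path_sum a : a \in X ->
  \sum_(x in cells tX | x != inl a) path_prod tX (inl a) x * ((valency tX x)%:R - 2) =
  \sum_(x in cells t | x != a) path_prod t a x * ((valency t x)%:R - 2).
Proof.
move=> aX; have aS : a \in VX t v0 X :|: X by rewrite inE aX orbT.
have vS := v0_skeleton; have aA := subsetP XA _ aX; have aC := XC aX.
rewrite (path_sum edgeP treeP aC v0C rootP (arrowP aA)).
have aC' := aS; have vC' := vS; rewrite -TX_cells_inl in aC'; rewrite -TX_cells_inl in vC'.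
rewrite (path_sum TX_edge_cells TX_tree aC' vC' TX_rootP (TX_valency_inl aX)).
have EG := TX_gamma vS aS; rewrite EG big_map; congr (_ - 1).
have QE u : u \in gamma t v0 a ->
    Qg tX [seq inl w | w <- gamma t v0 a] (inl u) = Qg t (gamma t v0 a) u.
  by move=> uG; apply: TX_Qg => [e|]; [apply: gamma_EX | apply: gamma_skeleton uG].
rewrite big_seq_cond [RHS]big_seq_cond; apply: eq_big => [x|x /andP[xG xa]] //.
have xS := gamma_skeleton vS aS xG.
rewrite !TX_gamma // QE // pedges_map_inl behead_map !big_map; congr (_ * ((_ - 1) * _)).
  apply: eq_big_seq => u uG; apply: QE; move: uG (GP aX); case/splitPr: xG => s1 s2.
  move=> + pP; rewrite (gamma_eq treeP (is_path_suffix pP)) => us.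
  by rewrite mem_cat inE us !orbT.
by apply: eq_big => [e|e _]; rewrite ?liftS_inl ?qr_lift.
Qed.

End SubTree.

(** * Multiplicities and intersection numbers in terms of arrows *)

Section ArrowTree.
Variables (T : finType) (t : dtree T).
Hypothesis VA : [disjoint dV t & dA t].
Hypothesis edgeP : forall e, e \in dE t -> e \subset cells t /\ #|e| = 2%N.
Hypothesis treeP : is_tree t.
Hypothesis arrowP : forall a, a \in dA t -> valency t a = 1%N.

Lemma AnzP a : (a \in Anz t) = (a \in dA t) && (df t a != 0).
Proof. by rewrite !inE; case: (a \in dA t); rewrite ?andbT ?andbF. Qed.

Lemma Anz_arrow a : a \in Anz t -> a \in dA t.
Proof. by rewrite AnzP => /andP[]. Qed.

Lemma Anz_cell a : a \in Anz t -> a \in cells t.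
Proof. by move=> /Anz_arrow aA; rewrite inE aA orbT. Qed.

Lemma fr_neq0 a : a \in Anz t -> fr t a != 0.
Proof. by rewrite AnzP /fr intr_eq0 => /andP[]. Qed.

Definition branch_sum a : rat :=
  \sum_(x in cells t | x != a) path_prod t a x * ((valency t x)%:R - 2).

Definition cross_sum (X : {set T}) : rat :=
  \sum_(a in X) \sum_(b in X | b != a) xva t b a.

(** The nonzero arrows [b != a] occur in [branch_sum] but not on the left; having valency 1, each
    contributes [- xva t b a] there, which the last sum cancels. *)
Lemma sum_xva a : a \in Anz t ->
  \sum_(v in dV t :|: A0 t) xva t v a * ((valency t v)%:R - 2) =
  fr t a * branch_sum a + \sum_(b in Anz t | b != a) xva t b a.
Proof.
move=> aX; have aC := Anz_cell aX.
have -> : fr t a * branch_sum a =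
    \sum_(x in cells t | x != a) xva t x a * ((valency t x)%:R - 2).
  rewrite /branch_sum mulr_sumr; apply: eq_bigr => x /andP[xC xa].
  by rewrite (xva_path_prod edgeP treeP aC xC) mulrA.
rewrite [X in _ = X + _](bigID (fun x => x \in Anz t)) /=.
have -> : \sum_(x | (x \in cells t) && (x != a) && (x \in Anz t))
    xva t x a * ((valency t x)%:R - 2) = - \sum_(b in Anz t | b != a) xva t b a.
  rewrite -sumrN; apply: eq_big => [x|x /andP[_ /Anz_arrow/arrowP->]]; last by ring.
  by rewrite andbC; case: (boolP (x \in Anz t)) => [/Anz_cell->|].
rewrite addrAC addNr add0r; apply: eq_bigl => x.
have [->|xa] := eqVneq x a.
  rewrite andbF; apply/negP; rewrite AnzP in aX; case/andP: aX => aA fa.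
  by rewrite !inE (negPf fa) andbF orbF (disjointFl VA aA).
rewrite andbT AnzP !inE; case: (boolP (x \in dV t)) => [xV|] /=.
  by rewrite (disjointFr VA xV).
by move=> _; case: (x \in dA t) => //=; rewrite negbK.
Qed.

Lemma Mt_branch_sum :
  Mt t = - (\sum_(a in Anz t) fr t a * branch_sum a + cross_sum (Anz t)).
Proof.
rewrite /Mt /cross_sum -big_split /=; congr (- _).
under eq_bigr do rewrite /Nv mulr_suml.
by rewrite exchange_big /=; apply: eq_bigr => a aX; rewrite sum_xva.
Qed.

Lemma path_prod_sym a b : a \in cells t -> b \in cells t ->
  path_prod t a b = path_prod t b a.
Proof.
move=> aC bC; rewrite /path_prod (gamma_rev treeP aC bC).
rewrite (perm_big (gamma t a b)) ?perm_rev ?perm_refl //=.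
apply: eq_bigr => u _; apply: eq_bigl => e.
by rewrite pedges_rev mem_rev.
Qed.

Lemma exists_pedge (p : seq T) u : (1 < size p)%N -> u \in p ->
  exists2 e, e \in pedges p & u \in e.
Proof.
elim: p => [|x [|y s] IH] // _; rewrite inE => /predU1P[->|].
  by exists [set x; y]; rewrite ?mem_head ?set21.
case: s IH => [|z s] IH.
  by rewrite inE => /eqP->; exists [set x; y]; rewrite ?mem_head ?set22.
by case/IH=> // e eP ue; exists e => //; rewrite pedges_cons inE eP orbT.
Qed.

(** A path with at least one edge passing through an arrow contains its only edge; the size
    condition excludes the trivial path [[:: a]]. *)
Lemma Qg_arrow x y p a : is_path t x y p -> (1 < size p)%N -> a \in dA t -> a \in p ->
  Qg t p a = 1.
Proof.
move=> pP p1 aA ap; apply: big_pred0 => e; apply/negP=> /and3P[eE ae /negP]; apply.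
have [e' e'P ae'] := exists_pedge p1 ap.
have /eq_leq/card_le1_eqP vA := arrowP aA.
by rewrite (vA e' e) // inE ?eE ?ae ?ae' ?(is_path_edge pP e'P).
Qed.

(** [path_prod] also counts the two ends, where the factors are 1 by [Qg_arrow]. *)
Lemma Qstar_path_prod a b : a \in dA t -> b \in dA t -> b != a ->
  Qstar t (gamma t a b) = path_prod t b a.
Proof.
move=> aA bA ba; rewrite /Qstar /path_prod.
have aC : a \in cells t by rewrite inE aA orbT.
have bC : b \in cells t by rewrite inE bA orbT.
have pP := gammaP treeP aC bC; have [s Es] := is_path_head pP.
case: (lastP s) Es => [|s' w] Es.
  by move: pP; rewrite Es is_path_cons /= [a == b]eq_sym (negPf ba) andbF.
have Ew : w = b by move: pP; rewrite Es is_path_cons last_rcons => /and3P[_ /eqP].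
rewrite {w}Ew in Es; have p1 : (1 < size (gamma t a b))%N by rewrite Es /= size_rcons.
have /andP[ap bp] := is_path_mem pP.
move: (Qg_arrow pP p1 aA ap) (Qg_arrow pP p1 bA bp); move: (Qg t _) => F Fa Fb.
rewrite Es /= size_rcons /= -cats1 take_size_cat // big_cons big_cat big_seq1 /=.
by rewrite Fa Fb mul1r mulr1.
Qed.

Lemma II_term a b : a \in Anz t -> b \in Anz t -> b != a ->
  Qstar t (gamma t a b) * fr t a * fr t b = xva t b a * fr t b.
Proof.
move=> aX bX ba; rewrite (xva_path_prod edgeP treeP (Anz_cell aX) (Anz_cell bX)).
by rewrite Qstar_path_prod ?Anz_arrow // path_prod_sym ?Anz_cell //; ring.
Qed.

Lemma xva_sym a b : a \in Anz t -> b \in Anz t -> xva t b a * fr t b = xva t a b * fr t a.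
Proof.
move=> aX bX; have aC := Anz_cell aX; have bC := Anz_cell bX.
by rewrite !(xva_path_prod edgeP treeP) // path_prod_sym //; ring.
Qed.

Lemma II1 a (Y : {set T}) :
  II t [set a] Y = \sum_(b in Y | b != a) Qstar t (gamma t a b) * fr t a * fr t b.
Proof. by rewrite /II big_set1. Qed.

(** Dividing [II t [set a] X] by [fr t a] leaves the sum of [xva t a b] over [b]; summed over [a],
    this is [cross_sum X] with its indices exchanged. *)
Lemma II_cross (X : {set T}) : X \subset Anz t ->
  \sum_(a in X) (1 - (fr t a)^-1) * II t [set a] X = II t X X - cross_sum X.
Proof.
move=> /subsetP XS.
have -> : cross_sum X = \sum_(a in X) (fr t a)^-1 * II t [set a] X.
  rewrite /cross_sum (exchange_big_dep (mem X)) /=; last by move=> a b _ /andP[].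
  apply: eq_bigr => b bX; rewrite II1 mulr_sumr; apply: eq_big => [a|a /and3P[aX _ ba]].
    by rewrite bX eq_sym.
  have [aS bS] := (XS a aX, XS b bX).
  by rewrite II_term // 1?eq_sym // -(xva_sym aS bS) mulrC mulfK ?fr_neq0.
rewrite [II t X X]/II -sumrB; apply: eq_bigr => a aX.
by rewrite mulrBl mul1r II1.
Qed.

Lemma II1_setD a (X : {set T}) : X \subset Anz t ->
  II t [set a] (Anz t :\: X) = II t [set a] (Anz t) - II t [set a] X.
Proof.
move=> XS; rewrite !II1 [X in _ = X - _](bigID (fun b => b \in X)) /=.
rewrite [X in _ = X + _ - _](eq_bigl (fun b => (b \in X) && (b != a))) => [|b].
  rewrite addrAC subrr add0r; apply: eq_bigl => b.
  by rewrite in_setD andbC [LHS]andbCA andbA [RHS]andbC andbCA andbC.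
by rewrite andbC; case: (boolP (b \in X)) => // /(subsetP XS)->.
Qed.

(** Replacing the complement of [X] by the whole minus [X] gives a first sum whose terms do not
    depend on [X], so it adds up over a partition. *)
Lemma frakM_split (X : {set T}) : X \subset Anz t ->
  frakM t X = \sum_(a in X) (1 - (fr t a)^-1) * II t [set a] (Anz t)
              - (II t X X - cross_sum X).
Proof.
move=> XS; rewrite -II_cross // -sumrB; apply: eq_bigr => a _.
by rewrite II1_setD // mulrBr.
Qed.

Lemma II_partition (P : {set {set T}}) : partition P (Anz t) ->
  \sum_(X in P) \sum_(Y in P | Y != X) II t X Y =
  II t (Anz t) (Anz t) - \sum_(X in P) II t X X.
Proof.
move=> PP; rewrite {2}/II (set_partition_big _ PP) /= -sumrB; apply: eq_bigr => X XP.
rewrite [in X in _ = X - _](eq_bigr (fun a => \sum_(Y in P) \sum_(b in Y | b != a)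
  Qstar t (gamma t a b) * fr t a * fr t b)) => [|a _]; last first.
  by rewrite (set_partition_big_cond _ PP).
by rewrite [Z in _ = Z - _]exchange_big [Z in _ = Z - _](bigD1 X) //= /II addrAC subrr add0r.
Qed.

End ArrowTree.

(** * The multiplicity of [TX] *)

Section SubTreeMultiplicity.
Variables (T : finType) (t : dtree T) (v0 : T) (X : {set T}).
Hypothesis VA : [disjoint dV t & dA t].
Hypothesis edgeP : forall e, e \in dE t -> e \subset cells t /\ #|e| = 2%N.
Hypothesis treeP : is_tree t.
Hypothesis arrowP : forall a, a \in dA t -> valency t a = 1%N.
Hypothesis v0V : v0 \in dV t.
Hypothesis rootP : forall x, x \in cells t ->
  (#|[set e in dE t | [&& x \in e, e \notin pedges (gamma t v0 x) & dq t e x != 1%R]]|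
     <= 1)%N.
Hypothesis XA : X \subset Anz t.
Hypothesis X0 : X != set0.

Local Notation tX := (TX t v0 X).

Let XdA : X \subset dA t.
Proof. by apply/subsetP=> a /(subsetP XA)/Anz_arrow. Qed.

Lemma TX_disjoint : [disjoint dV tX & dA tX].
Proof.
rewrite -setI_eq0; apply/eqP/setP=> c; rewrite in_set0; apply/negP=> /setIP[].
case/imsetP=> x /setIdP[xV _] ->; rewrite in_setU => /orP[|/imsetP[] //].
by rewrite liftS_inl => /(subsetP XdA); rewrite (disjointFr VA xV).
Qed.

Lemma TX_arrowP c : c \in dA tX -> valency tX c = 1%N.
Proof.
rewrite in_setU => /orP[/imsetP[a aX ->]|/imsetP[v vN ->]].
  exact: TX_valency_inl.
exact: TX_valency_inr.
Qed.

(** The new arrows all carry the decoration 0. *)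
Lemma TX_Anz : Anz tX = liftS X.
Proof.
apply/setP=> -[x|v]; rewrite AnzP in_setU ?liftS_inr ?liftS_inl /= ?eqxx ?andbF //.
have -> : (inl x \in [set inr v | v in newV t v0 X]) = false by apply/imsetP=> -[].
rewrite orbF; case: (boolP (x \in X)) => // /(subsetP XA).
by rewrite AnzP => /andP[_ ->].
Qed.

(** This is [Mt_branch_sum] for [TX]: branch sums and path products between arrows of [X] are those
    of [t], so only the range of summation shrinks. *)
Lemma TX_Mt :
  Mt tX = - (\sum_(a in X) fr t a * branch_sum t a + cross_sum t X).
Proof.
have eP := TX_edge_cells VA edgeP treeP arrowP v0V XdA.
have tP := TX_tree VA edgeP treeP arrowP v0V XdA.
rewrite (Mt_branch_sum TX_disjoint eP tP TX_arrowP) TX_Anz.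
have I1 : {in X &, injective (inl : T -> T + T)} by move=> x y _ _ [].
have XS a : a \in X -> a \in VX t v0 X :|: X by move=> aX; rewrite inE aX orbT.
rewrite /cross_sum !big_imset //=; congr (- (_ + _)); apply: eq_bigr => a aX.
  by congr (_ * _); apply: TX_path_sum.
rewrite big_imset_cond //=; apply: eq_bigr => b /andP[bX ba].
have SC c : c \in X -> inl c \in cells tX.
  by move=> cX; rewrite TX_cells_inl XS.
rewrite (xva_path_prod eP tP) ?SC // (xva_path_prod edgeP treeP) ?Anz_cell ?(subsetP XA) //.
by rewrite TX_path_prod ?XS.
Qed.

End SubTreeMultiplicity.

Theorem theorem4p16 (T : finType) (t : dtree T) (v0 : T) (P : {set {set T}}) :
  decorated_tree t -> pseudo_root t v0 -> partition P (Anz t) ->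
  Mt t = \sum_(a in Anz t) Mt (TX t v0 [set a]) + \sum_(a in Anz t) frakM t [set a]
         - II t (Anz t) (Anz t)
  /\
  Mt t = \sum_(X in P) Mt (TX t v0 X) + \sum_(X in P) frakM t X
         - \sum_(X in P) \sum_(Y in P | Y != X) II t X Y.
Proof.
move=> [VA [edgeP treeP arrowP _ _]] [v0V q0 qP] PP.
(* The bound extends to all cells: an arrow has one edge, and at [v0] every decoration is 1. *)
have rootP x : x \in cells t ->
  (#|[set e in dE t | [&& x \in e, e \notin pedges (gamma t v0 x) & dq t e x != 1%R]]|
     <= 1)%N.
  rewrite inE => /orP[xV|/arrowP <-]; last first.
    by apply/subset_leq_card/subsetP=> e; rewrite !in_set => /and3P[-> -> _].
  have [->|] := eqVneq x v0; last exact: qP.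
  apply/card_le1_eqP=> e e'; rewrite in_set => /and4P[eE ve _].
  by rewrite (q0 _ eE ve) eqxx.
have MX (X : {set T}) : X \subset Anz t -> X != set0 -> Mt (TX t v0 X) =
    - (\sum_(a in X) fr t a * branch_sum t a + cross_sum t X).
  by move=> XS X0; apply: TX_Mt.
rewrite (Mt_branch_sum VA edgeP treeP arrowP).
have IA := II_cross edgeP treeP arrowP (subxx (Anz t)).
have frakE := frakM_split edgeP treeP arrowP.
split.
  (* For (a), self-intersections and cross sums vanish on singletons, and [IA] evaluates what
     remains. *)
  rewrite -[Z in _ = Z - _]big_split [Z in _ = Z - _](eq_bigr
    (fun a => (1 - (fr t a)^-1) * II t [set a] (Anz t)
       - fr t a * branch_sum t a)) /= => [|a aA].
    by rewrite sumrB IA; ring.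
  have aS : [set a] \subset Anz t by rewrite sub1set.
  rewrite MX ?frakE ?set10 //; last by apply/set0Pn; exists a; rewrite set11.
  have -> : II t [set a] [set a] = 0.
    by rewrite II1 big1 // => b /andP[/set1P->]; rewrite eqxx.
  have -> : cross_sum t [set a] = 0.
    by rewrite /cross_sum big_set1 big1 // => b /andP[/set1P->]; rewrite eqxx.
  by rewrite !big_set1; ring.
(* For (b), [cross_sum t X] cancels between [Mt (TX t v0 X)] and [frakM t X], and the terms
   [II t X X] cancel against those from [II_partition]. *)
rewrite (II_partition PP) -[Z in _ = Z - _]big_split [Z in _ = Z - _](eq_bigr
  (fun X : {set T} => (\sum_(a in X)
   (1 - (fr t a)^-1) * II t [set a] (Anz t) - \sum_(a in X) fr t a * branch_sum t a)
    - II t X X)) /= => [|X XP].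
  rewrite !sumrB -!(set_partition_big _ PP) /= IA; ring.
have XS : X \subset Anz t by rewrite -(cover_partition PP); apply: bigcup_sup XP.
have X0 : X != set0.
  by case/and3P: PP => _ _; apply: contraNneq => <-.
by rewrite MX // frakE //; ring.
Qed.
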